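(* Let $G$ be a finite group, let $[\alpha]\in M(G)=H^2(G,\mathbb{C}^* )$ be of order $n$ and let $r$ be a natural number. If $r$ is coprime with $n$, then $\mathbb{C}^{\alpha}G\cong\mathbb{C}^{\alpha^r}G$, and if $r$ is not coprime with $n$, then $c_{G,\alpha}>c_{G,\alpha^r}$. In particular, $\mathbb{C}^\alpha G\cong\mathbb{C}^{\alpha^r}G$ if and only if $\gcd(n,r)=1$.
   Context: For a $2$-cocycle $\alpha\in Z^2(G,\mathbb{C}^* )$ (trivial action), the twisted group algebra $\mathbb{C}^\alpha G$ has $\mathbb{C}$-basis $\{u_g\}_{g\in G}$ with multiplication $u_gu_h=\alpha(g,h)u_{gh}$. An $\alpha$-representation of $G$ is a map $\eta:G\to \mathrm{GL}(V)$, $V$ a finite-dimensional complex vector space, with $\eta(g)\eta(h)=\alpha(g,h)\eta(gh)$ for all $g,h\in G$; it is irreducible if $V$ has no proper non-zero $G$-invariant subspace. The number $c_{G,\alpha}$ is the greatest common divisor of the dimensions of the irreducible $\alpha$-representations of $G$. *)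

(* Defs.v *)
From HB Require Import structures.
From mathcomp Require Import all_boot all_order all_fingroup all_algebra all_field.
From mathcomp Require Import complex.
From mathcomp Require Import boolp classical_sets reals.

Set Implicit Arguments.
Unset Strict Implicit.
Unset Printing Implicit Defensive.

Import GRing.Theory.
Local Open Scope ring_scope.

(* Z^2(G, F^* ) for the trivial action. Cocycles are not assumed normalised. *)
Record cocycle (F : fieldType) (G : finGroupType) := Cocycle {
  cocycle_fun :> G -> G -> F;
  cocycle_neq0 : forall g h, cocycle_fun g h != 0;
  cocycleP : forall g h k,
    cocycle_fun g h * cocycle_fun (g * h)%g k =
    cocycle_fun h k * cocycle_fun g (h * k)%g
}.

Section Cohomology.
Variables (F : fieldType) (G : finGroupType).
Implicit Types alpha beta : cocycle F G.

Fact cocycle_exp_neq0 alpha r g h : alpha g h ^+ r != 0.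
Proof. by rewrite expf_neq0 ?cocycle_neq0. Qed.

Fact cocycle_expP alpha r g h k :
  alpha g h ^+ r * alpha (g * h)%g k ^+ r =
  alpha h k ^+ r * alpha g (h * k)%g ^+ r.
Proof. by rewrite -!exprMn cocycleP. Qed.

Definition cocycle_exp alpha (r : nat) : cocycle F G :=
  Cocycle (cocycle_exp_neq0 alpha r) (cocycle_expP alpha r).

(* alpha lies in B^2(G, F^* ), i.e. the class of alpha in H^2 is trivial. *)
Definition coboundary alpha : Prop :=
  exists lam : G -> F, (forall g, lam g != 0) /\
    (forall g h, alpha g h = lam g * lam h / lam (g * h)%g).

(* The order of [alpha] in H^2(G, F^* ) = Z^2 / B^2, where [alpha]^m is the
   class of the pointwise power alpha^m. *)
Definition class_has_order alpha (n : nat) : Prop :=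
  [/\ (0 < n)%N, coboundary (cocycle_exp alpha n) &
      forall m, (0 < m)%N -> coboundary (cocycle_exp alpha m) -> (n <= m)%N].

End Cohomology.

(* An element x of the twisted group algebra is the family of its coordinates
   in the basis (u_g), that is, x = \sum_g x g *: u_g. *)
Definition twisted_algebra (F : fieldType) (G : finGroupType)
  (alpha : cocycle F G) : Type := {ffun G -> F^o}.

Section TwistedAlgebra.
Variables (F : fieldType) (G : finGroupType) (alpha : cocycle F G).

HB.instance Definition _ := Vector.on (twisted_algebra alpha).

Implicit Types x y z : twisted_algebra alpha.

Definition tbasis (g : G) : twisted_algebra alpha :=
  [ffun k => (k == g)%:R : F^o].

Definition tmul x y : twisted_algebra alpha :=
  \sum_g \sum_h (x g * y h * alpha g h : F) *: tbasis (g * h)%g.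

Definition tone : twisted_algebra alpha := (alpha 1%g 1%g)^-1 *: tbasis 1%g.

Lemma tcoordD x y g : (x + y) g = x g + y g. Proof. exact: ffunE. Qed.
Lemma tcoordZ (a : F) x g : (a *: x) g = a * x g. Proof. exact: ffunE. Qed.
Lemma tbasisE g k : tbasis g k = (k == g)%:R. Proof. exact: ffunE. Qed.

Lemma tbasis_sum x : x = \sum_g (x g : F) *: tbasis g.
Proof.
apply/ffunP => k; rewrite sum_ffunE (bigD1 k) //= tcoordZ tbasisE eqxx mulr1.
by rewrite big1 ?addr0 // => g gk; rewrite tcoordZ tbasisE eq_sym (negPf gk) mulr0.
Qed.

Fact tmulDl : left_distributive tmul +%R.
Proof.
move=> x y z; rewrite /tmul -big_split; apply: eq_bigr => g _ /=.
rewrite -big_split; apply: eq_bigr => h _ /=.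
by rewrite -scalerDl tcoordD !mulrDl.
Qed.

Fact tmulDr : right_distributive tmul +%R.
Proof.
move=> x y z; rewrite /tmul -big_split; apply: eq_bigr => g _ /=.
rewrite -big_split; apply: eq_bigr => h _ /=.
by rewrite -scalerDl tcoordD mulrDr mulrDl.
Qed.

Fact tscalerAl (a : F) x y : a *: tmul x y = tmul (a *: x) y.
Proof.
rewrite /tmul scaler_sumr; apply: eq_bigr => g _.
rewrite scaler_sumr; apply: eq_bigr => h _.
by rewrite scalerA tcoordZ !mulrA.
Qed.

Fact tscalerAr (a : F) x y : a *: tmul x y = tmul x (a *: y).
Proof.
rewrite /tmul scaler_sumr; apply: eq_bigr => g _.
rewrite scaler_sumr; apply: eq_bigr => h _.
by rewrite scalerA tcoordZ !mulrA (mulrC a).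
Qed.

Lemma tmul_basis g h : tmul (tbasis g) (tbasis h) = alpha g h *: tbasis (g * h)%g.
Proof.
rewrite /tmul (bigD1 g) //= (bigD1 h) //= !tbasisE !eqxx !mul1r.
rewrite [X in _ + X + _]big1 ?addr0 => [|k kh]; last first.
  by rewrite !tbasisE (negPf kh) mulr0 mul0r scale0r.
rewrite big1 ?addr0 // => k kg; rewrite big1 // => l _.
by rewrite !tbasisE (negPf kg) !mul0r scale0r.
Qed.

Let tmul_suml (I : finType) (f : I -> twisted_algebra alpha) y :
  tmul (\sum_i f i) y = \sum_i tmul (f i) y.
Proof.
apply: (big_morph (tmul^~ y)) => [u v|]; first exact: tmulDl.
by rewrite -[0 in LHS](scale0r 0) -tscalerAl scale0r.
Qed.

Let tmul_sumr (I : finType) (f : I -> twisted_algebra alpha) x :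
  tmul x (\sum_i f i) = \sum_i tmul x (f i).
Proof.
apply: (big_morph (tmul x)) => [u v|]; first exact: tmulDr.
by rewrite -[0 in LHS](scale0r 0) -tscalerAr scale0r.
Qed.

Fact tmulA : associative tmul.
Proof.
move=> x y z.
rewrite [x]tbasis_sum !tmul_suml; apply: eq_bigr => g _.
rewrite [y]tbasis_sum !(tmul_suml, tmul_sumr); apply: eq_bigr => h _.
rewrite [z]tbasis_sum !tmul_sumr; apply: eq_bigr => k _.
rewrite -!(tscalerAl, tscalerAr) !tmul_basis -!tbasis_sum !scalerA mulgA.
congr (_ *: _); rewrite -!mulrA -cocycleP; congr (_ * (_ * _)).
exact: mulrCA.
Qed.

Let cocycle1l g : alpha 1%g g = alpha 1%g 1%g.
Proof.
have := cocycleP alpha 1%g 1%g g; rewrite !mul1g.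
by move/(mulIf (cocycle_neq0 alpha 1%g g)).
Qed.

Let cocycle1r g : alpha g 1%g = alpha 1%g 1%g.
Proof.
have := cocycleP alpha g 1%g 1%g; rewrite !mulg1.
by move/(mulIf (cocycle_neq0 alpha g 1%g)).
Qed.

Fact tmul1r : left_id tone tmul.
Proof.
move=> x; rewrite {1}[x]tbasis_sum tmul_sumr [RHS]tbasis_sum.
apply: eq_bigr => g _; rewrite -tscalerAr -tscalerAl tmul_basis mul1g cocycle1l.
by rewrite [_^-1 *: _]scalerA mulVf ?scale1r ?cocycle_neq0.
Qed.

Fact tmulr1 : right_id tone tmul.
Proof.
move=> x; rewrite {1}[x]tbasis_sum tmul_suml [RHS]tbasis_sum.
apply: eq_bigr => g _; rewrite -tscalerAl -tscalerAr tmul_basis mulg1 cocycle1r.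
by rewrite [_^-1 *: _]scalerA mulVf ?scale1r ?cocycle_neq0.
Qed.

Fact tone_neq0 : tone != 0.
Proof.
apply: contraNneq (cocycle_neq0 alpha 1%g 1%g) => /ffunP/(_ 1%g)/eqP.
by rewrite tcoordZ tbasisE eqxx mulr1 ffunE invr_eq0.
Qed.

HB.instance Definition _ := GRing.Zmodule_isNzRing.Build (twisted_algebra alpha)
  tmulA tmul1r tmulr1 tmulDl tmulDr tone_neq0.
HB.instance Definition _ :=
  GRing.Lmodule_isLalgebra.Build F (twisted_algebra alpha) tscalerAl.
HB.instance Definition _ :=
  GRing.Lalgebra_isAlgebra.Build F (twisted_algebra alpha) tscalerAr.
HB.instance Definition _ := Algebra_isFalgebra.Build F (twisted_algebra alpha).

Lemma tbasisM g h : tbasis g * tbasis h = alpha g h *: tbasis (g * h)%g.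
Proof. exact: tmul_basis. Qed.

End TwistedAlgebra.

Definition alg_iso (F : fieldType) (A B : algType F) : Prop :=
  exists f : {lrmorphism A -> B}, bijective f.

Section TwistedRepresentations.
Variables (F : fieldType) (G : finGroupType) (alpha : cocycle F G).

Definition twisted_repr (V : vectType F) (eta : G -> 'End(V)) : Prop :=
  (forall g, bijective (eta g)) /\
  (forall g h, (eta g \o eta h)%VF = alpha g h *: eta (g * h)%g).

(* The zero space is not irreducible. *)
Definition irr_twisted_repr (V : vectType F) (eta : G -> 'End(V)) : Prop :=
  [/\ twisted_repr eta, (fullv : {vspace V}) != 0%VS &
      forall U : {vspace V}, (forall g, (eta g @: U <= U)%VS) ->
        U = 0%VS \/ U = fullv].

Definition irr_dims : set nat :=
  [set d | exists (V : vectType F) (eta : G -> 'End(V)),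
             irr_twisted_repr eta /\ \dim (fullv : {vspace V}) = d]%classic.

End TwistedRepresentations.

(* Greatest with respect to divisibility; in particular, the gcd of a set
   containing no positive number is 0. *)
Definition is_gcd_of (S : set nat) (c : nat) : Prop :=
  (forall m, S m -> (c %| m)%N) /\
  (forall d, (forall m, S m -> (d %| m)%N) -> (d %| c)%N).

Definition set_gcd (S : set nat) : nat := xget 0%N (is_gcd_of S).

Lemma set_gcdP (S : set nat) : is_gcd_of S (set_gcd S).
Proof.
suff [c Sc] : exists c, is_gcd_of S c by apply: (@xgetPex _ 0%N (is_gcd_of S)); exists c.
have [[m [Sm m0]]|S0] := pselect (exists m, S m /\ (0 < m)%N); last first.
  exists 0%N; split=> [m Sm|d _]; last exact: dvdn0.
  by case: m Sm => [//|m] Sm; case: S0; exists m.+1.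
pose D d := forall k, S k -> (d %| k)%N.
exists (\big[lcmn/1%N]_(d < m.+1 | `[< D d >]) d); split=> [k Sk|d Dd].
  by elim/big_ind: _ => // [a b ak bk|i /asboolP/(_ k Sk)//]; rewrite dvdn_lcm ak.
have dm : (d < m.+1)%N by rewrite ltnS dvdn_leq ?Dd.
rewrite (bigD1 (Ordinal dm)) /=; last exact/asboolP.
exact: dvdn_lcml.
Qed.

Definition irr_dim_gcd (F : fieldType) (G : finGroupType) (alpha : cocycle F G) :
  nat := set_gcd (irr_dims alpha).

(* Main.v *)
From HB Require Import structures.
Require Import Defs.
From mathcomp Require Import all_boot all_order all_fingroup all_algebra all_field.
From mathcomp Require Import cyclic complex reals boolp ring.

(* If r is coprime to n, normalise alpha to take values in the n-th roots of
   unity.  The central element z = \sum_(g, h) u_g u_h u_g^-1 u_h^-1 acts on an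
   irreducible representation of dimension d by (|G| / d)^2, so the coefficient
   at 1 of z^e is, up to a factor, the power sum \sum_i d_i^2 (|G| / d_i)^(2e)
   over the irreducible representations.  It is rational, hence fixed by the
   automorphism zeta |-> zeta^r of Q(zeta), which turns it into the analogous sum
   for alpha^r.  Thus both algebras have the same matrix blocks.

   If a prime p divides n and r, tensor products and exterior powers relate the
   dimensions of representations.  Newton's identities (Adams operations) show
   that the gcd c(alpha^k) divides c(alpha) for k > 0.  Taking determinants, n
   divides every dimension m of an alpha-representation; as p divides m, the
   binomial 'C(m, p), the dimension of an alpha^p-representation, has p-adic
   valuation one less than m.  So c(alpha^r) has a smaller p-part. *)

Set Implicit Arguments.
Unset Strict Implicit.
Unset Printing Implicit Defensive.

Import Order.TTheory GRing.Theory Num.Theory.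
Import VectorInternalTheory.
Local Open Scope ring_scope.

(** * Twisted matrix representations *)

Lemma card_group_neq0 (F : numDomainType) (G : finGroupType) : (#|G|%:R : F) != 0.
Proof. by rewrite pnatr_eq0 -lt0n; apply/card_gt0P; exists 1%g. Qed.

Section MatrixRepresentations.
Variables (F : fieldType) (G : finGroupType).
Implicit Types (c : G -> G -> F) (alpha : cocycle F G).

(* Matrices act on row vectors, which reverses the order of the factors in
   the defining identity eta(g) eta(h) = c(g, h) eta(gh). *)
Definition trep c m (rho : G -> 'M[F]_m) : Prop :=
  rho 1%g = (c 1%g 1%g)%:M /\
  forall g h, rho h *m rho g = c g h *: rho (g * h)%g.

Definition trep_dim c (m : nat) : Prop := exists rho : G -> 'M[F]_m, trep c rho.

Lemma eq_trep_dim c c' m :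
  (forall g h, c g h = c' g h) -> trep_dim c m -> trep_dim c' m.
Proof.
move=> cc' [rho [rho1 rhoM]]; exists rho; split=> [|g h].
  by rewrite rho1 cc'.
by rewrite rhoM cc'.
Qed.

Lemma trep_unit alpha m (rho : G -> 'M[F]_m) g :
  trep alpha rho -> rho g \in unitmx.
Proof.
case=> rho1 rhoM; have := rhoM g g^-1%g; rewrite mulgV rho1 -scalemx1 scalerA.
set a := _ * _ => e; have a0 : a != 0 by rewrite mulf_neq0 ?cocycle_neq0.
have : a^-1 *: rho (g^-1)%g *m rho g = 1%:M.
  by rewrite -scalemxAl e scalerA mulVf // scale1r.
by move/mulmx1_unit => [].
Qed.

(** Tensor products, exterior powers and the regular representation have bases indexed by a finite
    type [I]; [enum_val] transports them to ordinals. *)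
Lemma trep_dim_index c (I : finType) (A : G -> I -> I -> F) :
  (forall i j, A 1%g i j = c 1%g 1%g *+ (i == j)) ->
  (forall g h i k, \sum_j A h i j * A g j k = c g h * A (g * h)%g i k) ->
  trep c (fun g => \matrix_(i < #|I|, j < #|I|) A g (enum_val i) (enum_val j)).
Proof.
move=> A1 AM; split=> [|g h]; apply/matrixP=> i k; rewrite !mxE.
  by rewrite A1 (inj_eq enum_val_inj).
rewrite -AM (reindex (@enum_val I predT)) /=; last exact/onW_bij/enum_val_bij.
by apply: eq_bigr => j _; rewrite !mxE.
Qed.

Lemma trep_dim1 : trep_dim (fun _ _ => 1) 1.
Proof. by exists (fun _ => 1%:M); split=> // g h; rewrite mulmx1 scale1r. Qed.

Lemma trep_dimM c c' m m' : trep_dim c m -> trep_dim c' m' ->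
  trep_dim (fun g h => c g h * c' g h) (m * m').
Proof.
move=> [rho [rho1 rhoM]] [rho' [rho'1 rho'M]].
have <- : #|{: 'I_m * 'I_m'}| = (m * m')%N by rewrite card_prod !card_ord.
pose A g (i j : 'I_m * 'I_m') := rho g i.1 j.1 * rho' g i.2 j.2.
eexists; apply: (@trep_dim_index _ _ A) => [i j|g h i k]; rewrite /A.
  rewrite rho1 rho'1 !mxE mulrnAr mulrnAl -mulrnA mulnb.
  by [].
transitivity ((rho h *m rho g) i.1 k.1 * (rho' h *m rho' g) i.2 k.2).
  rewrite !mxE big_distrlr pair_big /=; apply: eq_bigr => j _.
  by rewrite mulrACA.
by rewrite rhoM rho'M !mxE mulrACA.
Qed.

(** Taking determinants in the defining identity makes the m-th power of [alpha] the coboundary of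
    [\det (rho g)]. *)
Lemma trep_coboundary alpha m : trep_dim alpha m -> coboundary (cocycle_exp alpha m).
Proof.
move=> [rho R]; have U g : \det (rho g) != 0.
  by rewrite -unitfE -unitmxE; apply: trep_unit R.
exists (fun g => \det (rho g)); split=> // g h /=.
case: R => _ rhoM; apply: (mulIf (U (g * h)%g)).
by rewrite divfK // [RHS]mulrC -det_mulmx rhoM detZ.
Qed.

(** Division with remainder: the quotient of [mu] by a power of [lam] trivialises the power
    [m %% n], which minimality of [n] forces to be 0. *)
Lemma order_dvdn_coboundary alpha n m : class_has_order alpha n ->
  coboundary (cocycle_exp alpha m) -> (n %| m)%N.
Proof.
move=> [n0 [lam [lam0 lamE]] nmin] [mu [mu0 muE]].
have [m0|s0] := posnP (m %% n); first by rewrite /dvdn m0.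
suff: (n <= m %% n)%N by rewrite leqNgt ltn_mod n0.
apply: nmin => //; exists (fun g => mu g / lam g ^+ (m %/ n)); split=> [g|g h /=].
  by rewrite mulf_neq0 ?invr_eq0 ?expf_neq0.
have {muE} := muE g h; have {lamE} := lamE g h; rewrite /= => lamE muE.
have a0 : (alpha g h ^+ n) ^+ (m %/ n) != 0 by rewrite !expf_neq0 ?cocycle_neq0.
apply: (mulIf a0); rewrite -exprM -exprD mulnC addnC -divn_eq muE mulnC exprM lamE.
rewrite !exprMn exprVn invfM invrK; set x := _ ^+ _; set y := _ ^+ _; set z := _ ^+ _.
have x0 : x != 0 by rewrite expf_neq0.
have y0 : y != 0 by rewrite expf_neq0.
have z0 : z != 0 by rewrite expf_neq0.
have mu1 := mu0 (g * h)%g.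
by field; rewrite x0 y0 z0 mu1.
Qed.

End MatrixRepresentations.

(** * Exterior powers *)

Section CauchyBinet.
Variables (F : comNzRingType) (m k : nat).
Implicit Types (A : 'M[F]_(k, m)) (B : 'M[F]_(m, k)) (f : {ffun 'I_k -> 'I_m}).

Lemma det_rowsub_perm (p : nat) (B : 'M[F]_(p, k)) (f f' : 'I_k -> 'I_p) (s : 'S_k) :
  (forall i, f' i = f (s i)) -> \det (rowsub f' B) = (-1) ^+ s * \det (rowsub f B).
Proof.
move=> ff'; rewrite -det_perm -det_mulmx -row_permE; congr (\det _).
by apply/matrixP => i j; rewrite !mxE ff'.
Qed.

Lemma det_rowsub_ninj B f : ~~ injectiveb f -> \det (rowsub f B) = 0.
Proof.
move=> /injectivePn [i [j ij fij]]; apply: (determinant_alternate ij) => l.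
by rewrite !mxE fij.
Qed.

Lemma det_mulmx_rowsub A B :
  \det (A *m B) = \sum_(f : {ffun 'I_k -> 'I_m}) (\prod_i A i (f i)) * \det (rowsub f B).
Proof.
transitivity (\sum_(s : 'S_k) \sum_(f : {ffun 'I_k -> 'I_m})
   (-1) ^+ s * ((\prod_i A i (f i)) * \prod_i B (f i) (s i))).
  apply: eq_bigr => s _; rewrite -big_distrr /=; congr (_ * _).
  under eq_bigr do rewrite mxE.
  by rewrite bigA_distr_bigA; apply: eq_bigr => f _; rewrite big_split.
rewrite exchange_big; apply: eq_bigr => f _; rewrite /determinant big_distrr.
by apply: eq_bigr => s _; rewrite mulrCA; congr (_ * (_ * _)); apply: eq_bigr => i _; rewrite mxE.
Qed.

(* Summing over all maps instead of over the k-subsets counts every minor k!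
   times. *)
Lemma det_mulmx_ffun A B :
  (\det (A *m B)) *+ k`! = \sum_(f : {ffun 'I_k -> 'I_m}) \det (colsub f A) * \det (rowsub f B).
Proof.
(* Reindexing the maps by composition with [s] shows that every [s] contributes the full
   determinant, whence the factor k!. *)
transitivity (\sum_(s : 'S_k) \sum_(f : {ffun 'I_k -> 'I_m})
   (\prod_i A i (f (s i))) * ((-1) ^+ s * \det (rowsub f B))).
  rewrite -[in LHS]card_Sn -sumr_const [in LHS]big_mkcond; apply: eq_bigr => s _.
  rewrite det_mulmx_rowsub.
  rewrite (reindex_inj (h := fun f => [ffun i => f (s i)])) /=; last first.
    move=> f f' /ffunP e; apply/ffunP => i.
    by have := e (s^-1 i)%g; rewrite !ffunE permKV.
  apply: eq_bigr => f _; congr (_ * _).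
    by apply: eq_bigr => i _; rewrite ffunE.
  by apply: det_rowsub_perm => i; rewrite ffunE.
rewrite exchange_big; apply: eq_bigr => f _ /=.
rewrite /determinant big_distrl /=; apply: eq_bigr => s _.
rewrite mulrCA mulrA; congr (_ * _ * _); apply: eq_bigr => i _.
by rewrite mxE.
Qed.

Definition draws := {S : {set 'I_m} | #|S| == k}.

Lemma card_draws_sig : #|{: draws}| = 'C(m, k).
Proof. by rewrite card_sig -[in RHS](card_ord m) -card_draws cardsE. Qed.

Lemma draw_enum_subproof (S : draws) :
  exists f : 'I_k -> 'I_m, injective f /\ [set f i | i : 'I_k] = val S.
Proof.
case: S => S /= /eqP Sk; rewrite -Sk; exists enum_val; split; first exact: enum_val_inj.
apply/setP => x; apply/imsetP/idP => [[i _ ->]|xS]; first exact: enum_valP.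
by exists (enum_rank_in xS x); rewrite // enum_rankK_in.
Qed.

(** An arbitrary enumeration of [S]; its order affects minors only by a sign. *)
Definition draw_enum (S : draws) : 'I_k -> 'I_m := sval (cid (draw_enum_subproof S)).

Lemma draw_enum_inj S : injective (draw_enum S).
Proof. by rewrite /draw_enum; case: (cid _) => f []. Qed.

Lemma draw_enum_im S : [set draw_enum S i | i : 'I_k] = val S.
Proof. by rewrite /draw_enum; case: (cid _) => f []. Qed.

(** In the sum over all maps, the non-injective ones vanish and the k! injective maps with image [S]
    give equal terms, since the sign of a permutation occurs twice. Regularity of k! then allows
    cancellation. *)
Lemma cauchy_binet A B : GRing.lreg (k`!%:R : F) ->
  \det (A *m B) =
  \sum_(S : draws) \det (colsub (draw_enum S) A) * \det (rowsub (draw_enum S) B).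
Proof.
move=> reg; apply: reg; rewrite mulr_natl det_mulmx_ffun.
rewrite (bigID (fun f => injectiveb f)) /= [X in _ + X]big1 ?addr0; last first.
  by move=> f /det_rowsub_ninj ->; rewrite mulr0.
have imk f : injectiveb f -> #|[set f i | i : 'I_k]| == k.
  by move=> /injectiveP fi; rewrite card_imset // card_ord.
rewrite big_distrr /=.
(* Injective maps are grouped by image, which [insub] turns into a k-subset. *)
rewrite (partition_big (fun f => insub [set f i | i : 'I_k] : option draws)
           (fun o => o != None)) /=; last first.
  by move=> f /imk kf; rewrite insubT.
rewrite (reindex_omap Some id) /=; last by case.
rewrite (eq_bigl predT); last by move=> S; rewrite eqxx.
apply: eq_bigr => S _; set h := _ * \det (rowsub _ _); rewrite mulr_natl.
have PE f : injectiveb f && (insub [set f i | i : 'I_k] == Some S) =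
    (f \in [set f in ffun_on (mem (val S)) | injectiveb f]).
  rewrite inE andbC; have [fi|] := boolP (injectiveb f); last by rewrite !andbF.
  rewrite !andbT; apply/eqP/ffun_onP => [e i|e].
    by have := @insubT _ _ draws _ (imk f fi); rewrite e => -[->] /=; rewrite imset_f.
  rewrite (@insubT _ _ draws _ (imk f fi)); congr Some; apply/val_inj/eqP => /=.
  rewrite eqEcard (eqP (imk f fi)) (eqP (valP S)) leqnn andbT.
  by apply/fintype.subsetP => x /imsetP [i _ ->].
transitivity (\sum_(f in [set f : {ffun 'I_k -> 'I_m} in ffun_on (mem (val S))
    | injectiveb f]) h); last first.
  by rewrite sumr_const card_inj_ffuns_on card_ord (eqP (valP S)) ffactnn.
apply: eq_big => [f|f]; first exact: PE.
rewrite PE inE => /andP [/ffun_onP fS /injectiveP fi].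
(* [f] takes values in [S], so it factors through [draw_enum S]; injectivity makes the factor a
   permutation. *)
have ex i : {j | f i = draw_enum S j}.
  apply: cid; have := fS i; rewrite -draw_enum_im => /imsetP [j _ ->].
  by exists j.
have si : injective (fun i => sval (ex i)).
  by move=> i j e; apply: fi; rewrite (svalP (ex i)) (svalP (ex j)) e.
have fE i : f i = draw_enum S (perm si i) by rewrite permE; exact: (svalP (ex i)).
rewrite (det_rowsub_perm _ fE) -[X in X * _]det_tr.
have -> : (colsub f A)^T = rowsub f A^T by apply/matrixP => i j; rewrite !mxE.
rewrite (det_rowsub_perm _ fE) mulrACA -expr2 sqrr_sign mul1r /h.
rewrite -[X in _ = X * _]det_tr; congr (\det _ * _).
by apply/matrixP => i j; rewrite !mxE.
Qed.

End CauchyBinet.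

(** The matrices of k-minors describe the action on the k-th exterior power; Cauchy-Binet makes them
    multiplicative. *)
Lemma trep_dim_exterior (F : numFieldType) (G : finGroupType) (c : G -> G -> F) m k :
  trep_dim c m -> trep_dim (fun g h => c g h ^+ k) 'C(m, k).
Proof.
move=> [rho [rho1 rhoM]]; rewrite -card_draws_sig.
pose A g (S T : draws m k) := \det (mxsub (draw_enum S) (draw_enum T) (rho g)).
eexists; apply: (@trep_dim_index _ _ _ _ A) => [S T|g h S T]; rewrite /A.
  rewrite rho1; have [<-|ST] := eqVneq.
    rewrite -[RHS]det_scalar; congr (\det _); apply/matrixP => i j.
    by rewrite !mxE (inj_eq (@draw_enum_inj _ _ S)).
  (* For distinct k-subsets, some index of [S] lies outside [T], so this minor of a scalar matrix
     has a zero row. *)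
  have [i ni] : exists i, draw_enum S i \notin val T.
    apply/existsP; rewrite -negb_forall; apply: contra ST => /forallP sub.
    apply/eqP/val_inj/eqP; rewrite eqEcard (eqP (valP S)) (eqP (valP T)) leqnn andbT.
    by rewrite -draw_enum_im; apply/fintype.subsetP => x /imsetP [i _ ->].
  rewrite (expand_det_row _ i) big1 // => j _; rewrite !mxE.
  case: eqP => [e|_]; last by rewrite mul0r.
  by case/negP: ni; rewrite e -(draw_enum_im T) imset_f.
have := cauchy_binet (rowsub (draw_enum S) (rho h)) (colsub (draw_enum T) (rho g)).
have reg : GRing.lreg (k`!%:R : F) by apply/lregP; rewrite pnatr_eq0 -lt0n fact_gt0.
move=> /(_ reg) cb.
have -> : c g h ^+ k * \det (mxsub (draw_enum S) (draw_enum T) (rho (g * h)%g)) =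
    \det (rowsub (draw_enum S) (rho h) *m colsub (draw_enum T) (rho g)).
  rewrite -detZ; congr (\det _); rewrite -mxsub_mul rhoM.
  by apply/matrixP => i j; rewrite !mxE.
rewrite cb; apply: eq_bigr => U _.
by congr (_ * _); congr (\det _); apply/matrixP => i j; rewrite !mxE.
Qed.

(** * Divisibility of dimensions *)

(** Times (p-1)!, the binomial is the product of the m - i for 0 < i < p, none of which is divisible
    by [p]. *)
Lemma coprime_bin_pred p m : prime p -> (0 < m)%N -> (p %| m)%N ->
  coprime p 'C(m.-1, p.-1).
Proof.
move=> p_pr m0 pm.
suff : coprime p ('C(m.-1, p.-1) * (p.-1)`!) by rewrite coprimeMr => /andP [].
have lepm : (p.-1 <= m.-1)%N by rewrite -!subn1 leq_sub2r // dvdn_leq.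
rewrite bin_ffact ffact_prod; elim/big_ind: _ => [|x y cx cy|i _].
- exact: coprimen1.
- by rewrite coprimeMr cx.
rewrite prime_coprime // -subn1 -subnDA add1n.
have ip : (i.+1 < p)%N by rewrite -[X in (_ < X)%N](prednK (prime_gt0 p_pr)) ltnS.
apply/negP; rewrite dvdn_subr //; last by rewrite ltnW // (leq_trans ip) // dvdn_leq.
by move=> /(dvdn_leq (ltn0Sn i)); rewrite leqNgt ip.
Qed.

Section DimensionIdeals.
Variables (F : numFieldType) (G : finGroupType).
Implicit Types (a b : G -> G -> F) (alpha : cocycle F G).

(* Newton's identity [p_k = e_1 p_(k-1) - ... -+ k e_k], read on dimensions:
   the k-th Adams operation of an a-representation of dimension m is a virtual
   a^k-representation of dimension m. *)
Lemma trep_dim_newton k a m b y d : (0 < k)%N -> trep_dim a m -> trep_dim b y ->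
  (forall x, trep_dim (fun g h => a g h ^+ k * b g h) x -> (d %| x)%N) ->
  (d %| m * y)%N.
Proof.
elim/ltn_ind: k b y => k IH b y k0 am bY dk.
(* Write a^k b as a^(k-i) times a^i b and apply induction with a^i b in place of [b], on the tensor
   product with the i-th exterior power. *)
have dlow i : (0 < i < k)%N -> (d %| m * ('C(m, i) * y))%N.
  case/andP=> i0 ik; apply: (IH (k - i)%N _ (fun g h => a g h ^+ i * b g h)).
  - by rewrite ltn_subrL i0 k0.
  - by rewrite subn_gt0.
  - by [].
  - exact: trep_dimM (trep_dim_exterior i am) bY.
  move=> x xD; apply: dk; apply: eq_trep_dim xD => g h.
  by rewrite mulrA -exprD subnK // ltnW.
have dtop : (d %| 'C(m, k) * y)%N.
  by apply: dk; apply: trep_dimM (trep_dim_exterior k am) bY.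
(* Descent from j = k to j = 1: up to the factor y, adding j C(m, j) to (j+1) C(m, j+1) = (m-j) C(m,
   j) gives m C(m, j), which [dlow] controls. *)
suff desc t : (t < k)%N -> (d %| (k - t) * 'C(m, k - t) * y)%N.
  by have := desc k.-1; rewrite -subn1 subKn // ltn_subrL k0 bin1 mul1n; apply.
elim: t => [_|t IHt tk]; first by rewrite subn0 -mulnA dvdn_mull //.
have {IHt} := IHt (ltnW tk); set j := (k - t.+1)%N.
have -> : (k - t = j.+1)%N by rewrite /j -subSn ?subSS // ltnW.
rewrite mul_bin_left => dj.
have [mj|jm] := ltnP m j; first by rewrite bin_small // muln0 mul0n.
rewrite -(dvdn_addr _ dj) -!mulnDl subnK // -mulnA; apply: dlow.
by rewrite /j subn_gt0 tk ltn_subrL k0.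
Qed.

Lemma trep_dim_adams k a m d : (0 < k)%N -> trep_dim a m ->
  (forall x, trep_dim (fun g h => a g h ^+ k) x -> (d %| x)%N) -> (d %| m)%N.
Proof.
move=> k0 am dk; rewrite -[m]muln1.
apply: (trep_dim_newton k0 am (trep_dim1 _ _)) => x xD; apply: dk.
by apply: eq_trep_dim xD => g h; rewrite mulr1.
Qed.

(** If c' = c, then [c] divides every C(m, p) for a prime [p] dividing [r] and [n]. The identity m
    C(m-1, p-1) = p C(m, p) then gives every [m] one factor [p] more than [c] has, against the
    choice of [c]. *)
Lemma trep_dim_gcd_lt alpha n r c c' : class_has_order alpha n ->
  ~~ coprime r n -> (0 < c)%N -> is_gcd_of (trep_dim alpha) c ->
  is_gcd_of (trep_dim (cocycle_exp alpha r)) c' -> (c' < c)%N.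
Proof.
move=> ord ncop c0 [cdvd cmax] [c'dvd _].
have nc : (n %| c)%N.
  by apply: cmax => m am; apply: order_dvdn_coboundary ord _; apply: trep_coboundary.
(* For r = 0 the power is the trivial cocycle, with a representation of dimension 1, while [c] is a
   multiple of n > 1. *)
have [r0|r0] := posnP r.
  have -> : c' = 1%N.
    apply/eqP; rewrite -dvdn1; apply: c'dvd; apply: eq_trep_dim (trep_dim1 F G) => g h.
    by rewrite r0.
  case: ord => n0 _ _; apply: leq_trans (dvdn_leq c0 nc).
  by case: n n0 ncop {nc} => [|[|n]] //; rewrite coprimen1.
have dv : (c' %| c)%N by apply: cmax => m am; apply: trep_dim_adams r0 am _ => x /c'dvd.
rewrite ltn_neqAle dvdn_leq // andbT; apply: contra ncop => /eqP cc'.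
rewrite /coprime; apply: contraT => g1.
have gp : (0 < gcdn r n)%N by rewrite gcdn_gt0 r0.
have [p p_pr] : exists2 p, prime p & (p %| gcdn r n)%N.
  by exists (pdiv (gcdn r n)); rewrite ?pdiv_dvd ?pdiv_prime // ltn_neqAle eq_sym g1.
rewrite dvdn_gcd => /andP [pr pn].
have p0 := prime_gt0 p_pr.
(* The power r/p of alpha^p is alpha^r, so the Adams divisibility applies to the p-th exterior
   power. *)
have c_ext m : trep_dim alpha m -> (c %| 'C(m, p))%N.
  move=> am; rewrite -cc'.
  apply: (@trep_dim_adams (r %/ p) (fun g h => alpha g h ^+ p)).
  - by rewrite divn_gt0 // dvdn_leq.
  - exact: trep_dim_exterior.
  move=> x xD; apply: c'dvd; apply: eq_trep_dim xD => g h /=.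
  by rewrite -exprM mulnC divnK.
have: (p ^ (logn p c).+1 %| c)%N.
  apply: cmax => m am.
  have pm : (p %| m)%N by rewrite (dvdn_trans pn) // (dvdn_trans nc) // cdvd.
  have [->|m0] := posnP m; first exact: dvdn0.
  rewrite -(Gauss_dvdl _ (coprimeXl _ (coprime_bin_pred p_pr m0 pm))) mul_bin_diag.
  rewrite prednK // expnS dvdn_pmul2l //; apply: dvdn_trans (c_ext m am).
  exact: pfactor_dvdnn.
by rewrite pfactor_dvdn // ltnn.
Qed.

End DimensionIdeals.

(** * Complete reducibility *)

Section Irreducibility.
Variables (F : numFieldType) (G : finGroupType) (alpha : cocycle F G).

Definition tstable k m (rho : G -> 'M[F]_m) (U : 'M_(k, m)) : Prop :=
  forall g, (U *m rho g <= U)%MS.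

(** [U] stands for its row space; square matrices represent all subspaces. *)
Definition tirr m (rho : G -> 'M[F]_m) : Prop :=
  (0 < m)%N /\ forall U : 'M_m, tstable rho U -> U = 0 \/ row_full U.

Lemma trep_invmx m (rho : G -> 'M[F]_m) g : trep alpha rho ->
  invmx (rho g) = (alpha g^-1%g g * alpha 1%g 1%g)^-1 *: rho g^-1%g.
Proof.
move=> R; have U := trep_unit g R; case: R => rho1 rhoM.
apply: (can_inj (mulKmx U)); rewrite mulmxV // -scalemxAr rhoM mulVg rho1.
by rewrite !scale_scalar_mx mulVf // mulf_neq0 ?cocycle_neq0.
Qed.

(** After substituting hg for g, the factor [alpha h g] arises from both representations and
    cancels. *)
Lemma trep_avg m m' (rho : G -> 'M[F]_m) (rho' : G -> 'M[F]_m') M h :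
  trep alpha rho -> trep alpha rho' ->
  (\sum_g invmx (rho g) *m M *m rho' g) *m rho' h =
  rho h *m (\sum_g invmx (rho g) *m M *m rho' g).
Proof.
move=> R R'; have U g := trep_unit g R.
rewrite mulmx_suml mulmx_sumr [RHS](reindex_inj (mulgI h)).
apply: eq_bigr => g _; rewrite -!mulmxA (proj2 R').
have -> : invmx (rho g) = (alpha h g)^-1 *: (rho h *m invmx (rho (h * g)%g)).
  apply: (can_inj (mulKmx (U g))); rewrite mulmxV // -scalemxAr mulmxA (proj2 R).
  by rewrite -scalemxAl scalerA mulVf ?cocycle_neq0 // scale1r mulmxV.
by rewrite -!(scalemxAl, scalemxAr) scalerA mulVf ?cocycle_neq0 // scale1r -!mulmxA.
Qed.

Lemma trep_sub k m (rho : G -> 'M[F]_m) (B : 'M_(k, m)) :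
  trep alpha rho -> row_free B -> tstable rho B ->
  exists2 rhoB : G -> 'M_k, trep alpha rhoB & forall g, rhoB g *m B = B *m rho g.
Proof.
move=> [rho1 rhoM] Bf Bst; exists (fun g => B *m rho g *m pinvmx B); last first.
  by move=> g; rewrite mulmxKpV.
have E g : B *m rho g *m pinvmx B *m B = B *m rho g by rewrite mulmxKpV.
split=> [|g h]; apply: (row_free_inj Bf) => /=.
  by rewrite E rho1 mul_mx_scalar mul_scalar_mx.
by rewrite -mulmxA E mulmxA E -mulmxA rhoM -scalemxAl E -scalemxAr.
Qed.

(** The average [Q] of the projection [P] onto [U] is an intertwining projection onto [U]; its
    kernel is the stable complement. *)
Lemma maschke m (rho : G -> 'M[F]_m) (U : 'M_m) : trep alpha rho -> tstable rho U ->
  exists W : 'M_m, [/\ tstable rho W, (\rank U + \rank W)%N = m & row_full (U + W)%MS].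
Proof.
move=> R Ust; pose P := pinvmx U *m U.
pose T := \sum_g invmx (rho g) *m P *m rho g.
pose Q := (#|G|%:R : F)^-1 *: T.
have n0 := card_group_neq0 F G.
have Qcomm g : Q *m rho g = rho g *m Q.
  by rewrite -scalemxAl -scalemxAr trep_avg.
have UQ : U *m Q = U.
  rewrite -scalemxAr mulmx_sumr (eq_bigr (fun _ => U)) => [|g _].
    by rewrite sumr_const -scaler_nat scalerA mulVf ?scale1r.
  have e : U *m invmx (rho g) *m P = U *m invmx (rho g).
    by rewrite mulmxA mulmxKpV // (trep_invmx _ R) -scalemxAr scalemx_sub.
  by rewrite mulmxA [U *m _]mulmxA e mulmxKV ?(trep_unit g R).
have QU : (Q <= U)%MS.
  apply/scalemx_sub/summx_sub => g _; apply: submx_trans (Ust g).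
  by rewrite submxMr // mulmxA submxMl.
have QQ : Q *m Q = Q by have /submxP [A eA] := QU; rewrite {1}eA -mulmxA UQ -eA.
exists (kermx Q); split.
- by move=> g; apply/sub_kermxP; rewrite -mulmxA -Qcomm mulmxA mulmx_ker mul0mx.
- have -> : \rank U = \rank Q.
    by apply/eqP; rewrite eqn_leq [in X in _ && X]mxrankS // -{1}UQ mxrankM_maxr.
  by rewrite mxrank_ker subnKC // rank_leq_row.
rewrite -sub1mx -(subrK Q 1%:M) addrC addmx_sub_adds //.
by apply/sub_kermxP; rewrite mulmxBl mul1mx QQ subrr.
Qed.

(** Complete reducibility as an induction principle. The rows of [B1] and [B2] are bases of
    complementary stable subspaces. *)
Lemma trep_ind (P : forall m, (G -> 'M[F]_m) -> Prop) :
  (forall rho : G -> 'M_0, P 0 rho) ->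
  (forall m (rho : G -> 'M_m), trep alpha rho -> tirr rho -> P m rho) ->
  (forall m (rho : G -> 'M_m) k1 k2 (rho1 : G -> 'M_k1) (rho2 : G -> 'M_k2)
      (B1 : 'M_(k1, m)) (B2 : 'M_(k2, m)),
    (k1 + k2)%N = m -> row_full (B1 + B2)%MS ->
    (forall g, rho1 g *m B1 = B1 *m rho g) ->
    (forall g, rho2 g *m B2 = B2 *m rho g) ->
    P k1 rho1 -> P k2 rho2 -> P m rho) ->
  forall m (rho : G -> 'M_m), trep alpha rho -> P m rho.
Proof.
move=> P0 Pirr Psum m; elim/ltn_ind: m => m IH rho R.
have [m0|m0] := posnP m; first by subst m.
have [irr|nirr] := pselect (tirr rho); first exact: Pirr.
have [U [Ust U0 Uf]] : exists U : 'M_m, [/\ tstable rho U, U <> 0 & ~ row_full U].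
  apply: contrapT => nex; apply: nirr; split=> // U Ust.
  by apply: contrapT => /not_orP [U0 Uf]; apply: nex; exists U.
have [W [Wst rk UW]] := maschke R Ust.
have rU0 : (0 < \rank U)%N by rewrite lt0n mxrank_eq0; apply/eqP.
have rUm : (\rank U < m)%N by rewrite ltn_neqAle rank_leq_col andbT; apply/negP.
have base_st k (A : 'M_(k, m)) : tstable rho A -> tstable rho (row_base A).
  by move=> Ast g; rewrite (eqmxMr _ (eq_row_base A)) eq_row_base.
have [r1 R1 E1] := trep_sub R (row_base_free U) (base_st _ _ Ust).
have [r2 R2 E2] := trep_sub R (row_base_free W) (base_st _ _ Wst).
apply: (Psum _ _ _ _ r1 r2 (row_base U) (row_base W)) => //.
- by rewrite /row_full (adds_eqmx (eq_row_base U) (eq_row_base W)).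
- exact: IH.
by apply: IH => //; rewrite -[X in (_ < X)%N]rk -[X in (X < _)%N]add0n ltn_add2r.
Qed.

Lemma tirr_irr_dims m (rho : G -> 'M[F]_m) :
  trep alpha rho -> tirr rho -> irr_dims alpha m.
Proof.
move=> R [m0 irr]; exists 'rV[F]_m.
pose eta g : 'End('rV[F]_m) := linfun (mulmxr (rho g)); exists eta.
have etaE g v : eta g v = v *m rho g by rewrite lfunE.
have dimV : \dim (fullv : {vspace 'rV[F]_m}) = m.
  by rewrite dimvf; apply: etrans (dim_matrix _ _ _) (mul1n m).
split=> //; split=> [||U Ust].
- split=> [g|g h].
    have u := trep_unit g R; exists (mulmxr (invmx (rho g))) => v /=.
      by rewrite etaE mulmxK.
    by rewrite etaE mulmxKV.
  apply/lfunP => v; rewrite lfunE /= !etaE -mulmxA (proj2 R).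
  by rewrite -scalemxAr scale_lfunE etaE.
- by rewrite -dimv_eq0 dimV -lt0n.
(* The rows of [B] span [U], so stability of [U] becomes stability of a row space. *)
pose B := \matrix_(i < \dim U) (vbasis U)`_i.
have memB v : (v \in U) = (v <= B)%MS.
  apply/idP/submxP => [vU|[w ->]].
    exists (\row_i coord (vbasis U) i v); rewrite mulmx_sum_row {1}(coord_vbasis vU).
    by apply: eq_bigr => i _; rewrite mxE rowK.
  rewrite mulmx_sum_row; apply: memv_suml => i _; rewrite rowK memvZ //.
  by apply: vbasis_mem; rewrite mem_nth // size_tuple.
have [|B0|Bf] := irr <<B>>%MS.
- move=> g; rewrite (eqmxMr _ (genmxE B)) genmxE; apply/row_subP => i.
  rewrite row_mul rowK -memB -etaE; apply/(subvP (Ust g))/memv_img.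
  by apply: vbasis_mem; rewrite mem_nth // size_tuple.
- left; apply/eqP; rewrite -subv0; apply/subvP => v.
  by rewrite memv0 -submx0 -B0 genmxE memB.
right; apply/eqP; rewrite eqEsubv subvf; apply/subvP => v _.
have := submx_full v Bf; by rewrite genmxE memB.
Qed.

Lemma irr_dims_trep_dim m : irr_dims alpha m -> trep_dim alpha m.
Proof.
move=> [V [eta [[[bij etaM] _ _] <-]]]; rewrite dimvf.
have f2mxE (f : 'End(V)) u : u *m f2mx f = v2r (f (r2v u)).
  by rewrite unlock /= !r2vK.
exists (fun g => f2mx (eta g)); split=> [|g h]; apply/row_matrixP => i.
  rewrite !rowE f2mxE mul_mx_scalar -[RHS](r2vK) linearZ /=; congr (v2r _).
  (* That [eta 1] is a scalar follows by cancelling one injective factor in [eta 1 \o eta 1]. *)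
  have [inv etaK _] := bij 1%g; apply: (can_inj etaK).
  by rewrite linearZ /= -[LHS]comp_lfunE etaM mulg1 scale_lfunE.
rewrite !rowE mulmxA !f2mxE v2rK -scalemxAr f2mxE -linearZ /=; congr (v2r _).
by rewrite -[LHS]comp_lfunE etaM scale_lfunE.
Qed.

(** Dimensions add along a decomposition into irreducibles, so reducible representations do not
    change the gcd. *)
Lemma trep_dim_gcd : is_gcd_of (trep_dim alpha) (irr_dim_gcd alpha).
Proof.
have [cd cm] := set_gcdP (irr_dims alpha); split=> [m [rho R]|d dd].
  apply: (trep_ind (P := fun m _ => (irr_dim_gcd alpha %| m)%N)) R.
  - by [].
  - by move=> k r R irr; apply: cd; apply: tirr_irr_dims irr.
  by move=> k _ k1 k2 _ _ _ _ e _ _ _ d1 d2; rewrite -e dvdn_add.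
by apply: cm => m /irr_dims_trep_dim; apply: dd.
Qed.

End Irreducibility.

(** * The twisted group algebra *)

Section AlgebraStructure.
Variables (F : fieldType) (G : finGroupType) (alpha : cocycle F G).
Local Notation A := (twisted_algebra alpha).

Lemma talg_oneE : (1 : A) = (alpha 1%g 1%g)^-1 *: tbasis alpha 1%g.
Proof. by []. Qed.

Lemma talg_mulE (x y : A) :
  x * y = \sum_g \sum_h (x g * y h * alpha g h : F) *: tbasis alpha (g * h)%g.
Proof. by []. Qed.

Lemma tbasis1E : tbasis alpha 1%g = (alpha 1%g 1%g)%:A.
Proof. by rewrite talg_oneE scalerA mulfV ?scale1r ?cocycle_neq0. Qed.

End AlgebraStructure.

(** * Isomorphisms of twisted group algebras *)

Section AlgebraIsomorphisms.
Variable F : fieldType.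

Lemma alg_isoI (A B : algType F) (f : A -> B) : linear f -> f 1 = 1 ->
  {morph f : x y / x * y} -> bijective f -> alg_iso A B.
Proof.
move=> flin f1 fM fbij.
pose lin := GRing.isLinear.Build F A B *:%R f flin.
pose mon := GRing.isMonoidMorphism.Build A B f (conj f1 fM).
pose f' : {lrmorphism A -> B} := HB.pack f lin mon.
by exists f'.
Qed.

Lemma alg_iso_trans (A B C : algType F) : alg_iso A B -> alg_iso B C -> alg_iso A C.
Proof.
move=> [f fb] [g gb]; exists (g \o f : {lrmorphism A -> C}).
exact: bij_comp.
Qed.

Variable G : finGroupType.
Implicit Types alpha beta : cocycle F G.

Lemma alg_iso_tbasis beta (B : algType F) (f : twisted_algebra beta -> B) :
  linear f -> f (tbasis beta 1%g) = (beta 1%g 1%g)%:A ->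
  (forall g h, f (tbasis beta g) * f (tbasis beta h) = beta g h *: f (tbasis beta (g * h)%g)) ->
  bijective f -> alg_iso (twisted_algebra beta) B.
Proof.
move=> flin f1 fM; pose lin := GRing.isLinear.Build F _ B *:%R f flin.
pose f' : {linear twisted_algebra beta -> B} := HB.pack f lin.
have fE x : f x = \sum_g (x g : F) *: f (tbasis beta g).
  rewrite -[f]/(f' : _ -> _) [in LHS](tbasis_sum x) linear_sum.
  by apply: eq_bigr => g _; rewrite linearZ.
apply: alg_isoI => // [|x y].
  rewrite talg_oneE -[f]/(f' : _ -> _) linearZ /= [f _]f1 scalerA mulVf ?scale1r //.
  exact: cocycle_neq0.
rewrite talg_mulE (fE x) (fE y) big_distrlr -[f]/(f' : _ -> _) linear_sum.
apply: eq_bigr => g _; rewrite linear_sum; apply: eq_bigr => h _.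
by rewrite linearZ /= -[RHS]scalerAr -[in RHS]scalerAl fM !scalerA (mulrC (x g : F)).
Qed.

(** The isomorphism rescales the basis vector of each [g] by [lam g]. *)
Lemma cohomologous_alg_iso alpha beta (lam : G -> F) : (forall g, lam g != 0) ->
  (forall g h, beta g h = alpha g h * (lam g * lam h / lam (g * h)%g)) ->
  alg_iso (twisted_algebra beta) (twisted_algebra alpha).
Proof.
move=> lam0 ab.
pose f (x : twisted_algebra beta) : twisted_algebra alpha :=
  [ffun g => lam g * x g : F^o].
have fE g : f (tbasis beta g) = lam g *: tbasis alpha g.
  apply/ffunP => k; rewrite tcoordZ ffunE !tbasisE.
  by case: eqP => [->//|_]; rewrite !mulr0.
apply: (alg_iso_tbasis (f := f)) => [a x y||g h|].
- apply/ffunP => g; rewrite tcoordD tcoordZ !ffunE mulrDr; congr (_ + _).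
  exact: mulrCA.
- by rewrite fE ab mulg1 mulfK // mulrC -scalerA tbasis1E.
- rewrite !fE -scalerAl -scalerAr tbasisM !scalerA; congr (_ *: _).
  by rewrite ab; field.
pose f' (x : twisted_algebra alpha) : twisted_algebra beta :=
  [ffun g => (lam g)^-1 * x g : F^o].
exists f' => x; apply/ffunP => g; rewrite !ffunE.
  exact: mulKf.
exact: mulVKf.
Qed.

End AlgebraIsomorphisms.

(** * Evaluation of representations on the algebra; the regular representation *)

Section Evaluation.
Variables (F : fieldType) (G : finGroupType) (alpha : cocycle F G).
Local Notation A := (twisted_algebra alpha).

Definition teval m (rho : G -> 'M[F]_m) (x : A) : 'M_m := \sum_g (x g : F) *: rho g.

Lemma teval_linear m (rho : G -> 'M[F]_m) : linear (teval rho).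
Proof.
move=> a x y; rewrite /teval scaler_sumr -big_split; apply: eq_bigr => g _ /=.
by rewrite tcoordD tcoordZ scalerDl scalerA.
Qed.

HB.instance Definition _ m (rho : G -> 'M[F]_m) :=
  GRing.isLinear.Build F A 'M[F]_m *:%R (teval rho) (teval_linear rho).

Lemma tevalZ m (rho : G -> 'M[F]_m) a x : teval rho (a *: x) = a *: teval rho x.
Proof. exact: linearZ. Qed.

Lemma teval_tbasis m (rho : G -> 'M[F]_m) g : teval rho (tbasis alpha g) = rho g.
Proof.
rewrite /teval (bigD1 g) //= tbasisE eqxx scale1r big1 ?addr0 // => h hg.
by rewrite tbasisE (negPf hg) scale0r.
Qed.

Lemma tevalM m (rho : G -> 'M[F]_m) x y : trep alpha rho ->
  teval rho (x * y) = teval rho y *m teval rho x.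
Proof.
move=> [_ rhoM]; rewrite talg_mulE linear_sum mulmx_sumr; apply: eq_bigr => g _.
rewrite linear_sum mulmx_suml; apply: eq_bigr => h _.
by rewrite linearZ /= teval_tbasis -scalemxAl -scalemxAr rhoM !scalerA (mulrC (y h)).
Qed.

Lemma teval1 m (rho : G -> 'M[F]_m) : trep alpha rho -> teval rho 1 = 1%:M.
Proof.
move=> [rho1 _]; rewrite talg_oneE.
by rewrite linearZ /= teval_tbasis rho1 scale_scalar_mx mulVf ?cocycle_neq0.
Qed.

Lemma teval_intertwine k m (rho : G -> 'M[F]_m) (rho' : G -> 'M[F]_k) (B : 'M_(k, m)) x :
  (forall g, rho' g *m B = B *m rho g) -> teval rho' x *m B = B *m teval rho x.
Proof.
move=> E; rewrite /teval mulmx_suml mulmx_sumr; apply: eq_bigr => g _.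
by rewrite -scalemxAl -scalemxAr E.
Qed.

(** Left multiplication by u_g sends u_k to alpha(g, k) u_(gk); rows are indexed by [k]. *)
Definition treg g (k l : G) : F := alpha g k *+ (l == g * k)%g.

Lemma treg_trep :
  trep alpha (fun g => \matrix_(i < #|G|, j < #|G|) treg g (enum_val i) (enum_val j)).
Proof.
apply: (@trep_dim_index _ _ _ _ treg) => [k l|g h k l].
  rewrite /treg mul1g eq_sym; congr (_ *+ _).
  have := cocycleP alpha 1%g 1%g k; rewrite !mul1g.
  by move/(mulIf (cocycle_neq0 alpha 1%g k)).
rewrite (bigD1 (h * k)%g) //= big1 ?addr0 => [|j jh]; last first.
  by rewrite /treg (negPf jh) mulr0n mul0r.
by rewrite /treg eqxx mulr1n !mulrnAr !mulgA cocycleP.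
Qed.

Lemma trep_dim_reg : trep_dim alpha #|G|.
Proof. by eexists; apply: treg_trep. Qed.

(** The row indexed by 1 records every coordinate of [x], up to the non-zero factor alpha(g, 1). *)
Lemma teval_reg_eq0 (x : A) :
  teval (fun g => \matrix_(i < #|G|, j < #|G|) treg g (enum_val i) (enum_val j)) x = 0 ->
  x = 0.
Proof.
move=> e; apply/ffunP => g; rewrite [RHS]ffunE.
have /matrixP/(_ (enum_rank 1%g) (enum_rank g)) := e.
rewrite /teval summxE (bigD1 g) //= big1 ?addr0 => [|h hg].
  rewrite !mxE !enum_rankK /treg mulg1 eqxx => /eqP.
  by rewrite mulf_eq0 (negPf (cocycle_neq0 _ _ _)) orbF => /eqP.
by rewrite !mxE !enum_rankK /treg mulg1 eq_sym (negPf hg) mulr0.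
Qed.

End Evaluation.

Lemma alg_iso_trep_dim (F : fieldType) (G : finGroupType) (alpha beta : cocycle F G) m :
  alg_iso (twisted_algebra alpha) (twisted_algebra beta) ->
  trep_dim beta m -> trep_dim alpha m.
Proof.
move=> [f _] [rho R]; exists (fun g => teval rho (f (tbasis alpha g))).
have fZ a (x : twisted_algebra alpha) : f (a *: x) = a *: f x by exact: linearZ.
have fM (x y : twisted_algebra alpha) : f (x * y) = f x * f y by exact: rmorphM.
split=> [|g h]; last by rewrite -tevalM // -fM tbasisM fZ tevalZ.
by rewrite tbasis1E fZ rmorph1 tevalZ teval1 // scalemx1.
Qed.

(** * Schur orthogonality *)

Lemma mxtrace_mul_delta (F : pzSemiRingType) m m' (X : 'M[F]_(m, m')) a b :
  \tr (X *m delta_mx b a) = X a b.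
Proof.
rewrite /mxtrace (bigD1 a) //= [X in _ + X]big1 ?addr0 => [|i ia]; rewrite !mxE.
  rewrite (bigD1 b) //= [X in _ + X]big1 ?addr0 => [|j jb]; rewrite !mxE !eqxx ?mulr1 //.
  by rewrite (negPf jb) mulr0.
by rewrite big1 // => j _; rewrite !mxE (negPf ia) andbF mulr0.
Qed.

Section Orthogonality.
Variables (F : numClosedFieldType) (G : finGroupType) (alpha : cocycle F G).
Local Notation A := (twisted_algebra alpha).
Local Notation N := (#|G|%:R : F).

Let N0 : N != 0.
Proof. exact: card_group_neq0. Qed.

Definition nohom m m' (rho : G -> 'M[F]_m) (rho' : G -> 'M[F]_m') : Prop :=
  forall X : 'M_(m, m'), (forall g, rho g *m X = X *m rho' g) -> X = 0.

Lemma schur m (rho : G -> 'M[F]_m) (X : 'M_m) : tirr rho ->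
  (forall g, rho g *m X = X *m rho g) -> exists a, X = a%:M.
Proof.
move=> [m0 irr] comm.
have /closed_rootP [a] : size (char_poly X) != 1%N by rewrite size_char_poly eqSS -lt0n.
rewrite -eigenvalue_root_char => /eigenvalueP [v vX v0]; exists a.
have [g|K0|Kf] := irr (kermx (X - a%:M)).
- apply/sub_kermxP; rewrite -mulmxA.
  have -> : rho g *m (X - a%:M) = (X - a%:M) *m rho g.
    by rewrite mulmxBr mulmxBl comm mul_mx_scalar mul_scalar_mx.
  by rewrite mulmxA mulmx_ker mul0mx.
- have: (v <= kermx (X - a%:M))%MS.
    by apply/sub_kermxP; rewrite mulmxBr vX mul_mx_scalar subrr.
  by rewrite K0 submx0 (negPf v0).
apply/eqP; rewrite -subr_eq0; have /sub_kermxP := submx_full 1%:M Kf.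
by rewrite mul1mx => ->.
Qed.

Lemma irr_dim_neq0 m (rho : G -> 'M[F]_m) : tirr rho -> (m%:R : F) != 0.
Proof. by case=> m0 _; rewrite pnatr_eq0 -lt0n. Qed.

(** By Schur's lemma the average is a scalar, found by comparing traces. *)
Lemma tirr_avg m (rho : G -> 'M[F]_m) (M : 'M_m) : trep alpha rho -> tirr rho ->
  \sum_g invmx (rho g) *m M *m rho g = (N * \tr M / m%:R)%:M.
Proof.
move=> R irr; have [|a avgE] := @schur _ rho (\sum_g invmx (rho g) *m M *m rho g) irr.
  by move=> g; rewrite (trep_avg _ _ R R).
rewrite avgE; congr (_%:M); have := congr1 mxtrace avgE.
rewrite mxtrace_scalar raddf_sum /= (eq_bigr (fun _ => \tr M)) => [|g _].
  have m0 := irr_dim_neq0 irr; rewrite sumr_const => e.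
  by apply: (mulIf m0); rewrite divfK // mulr_natr -e mulr_natl.
by rewrite -mulmxA mxtrace_mulC -mulmxA mulmxV ?mulmx1 ?(trep_unit g R).
Qed.

(** Reduces such sums to averages, which Schur's lemma evaluates; both orthogonality relations
    follow. *)
Lemma matrix_coef_avg m m' (rho : G -> 'M[F]_m) (rho' : G -> 'M[F]_m') (M : 'M_m) a b :
  (\sum_g \tr (invmx (rho g) *m M) *: rho' g) a b =
  \sum_c (\sum_g invmx (rho g) *m (M *m delta_mx c a) *m rho' g) c b.
Proof.
rewrite summxE; under [RHS]eq_bigr do rewrite summxE; rewrite exchange_big.
apply: eq_bigr => g _ /=; rewrite mxE mulr_suml; apply: eq_bigr => c _.
rewrite mulmxA [RHS]mxE (bigD1 a) //= [X in _ = _ + X]big1 ?addr0 => [|e ea].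
  congr (_ * _); rewrite [RHS]mxE (bigD1 c) //= [X in _ = _ + X]big1 ?addr0 => [|e ec].
    by rewrite [delta_mx _ _ _ _]mxE !eqxx mulr1.
  by rewrite [delta_mx _ _ _ _]mxE (negPf ec) mulr0.
rewrite [X in X * _]mxE big1 ?mul0r // => i _.
by rewrite [delta_mx _ _ _ _]mxE (negPf ea) andbF mulr0.
Qed.

Lemma tirr_ortho m (rho : G -> 'M[F]_m) (M : 'M_m) : trep alpha rho -> tirr rho ->
  \sum_g \tr (invmx (rho g) *m M) *: rho g = (N / m%:R) *: M.
Proof.
move=> R irr; apply/matrixP => a b; rewrite matrix_coef_avg.
under eq_bigr do rewrite (tirr_avg _ R irr) mxtrace_mul_delta.
rewrite (bigD1 b) //= big1 ?addr0 => [|c cb]; rewrite !mxE ?(negPf cb) //.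
by rewrite eqxx mulr1n mulrAC.
Qed.

Lemma nohom_ortho m m' (rho : G -> 'M[F]_m) (rho' : G -> 'M[F]_m') (M : 'M_m) :
  trep alpha rho -> trep alpha rho' -> nohom rho rho' ->
  \sum_g \tr (invmx (rho g) *m M) *: rho' g = 0.
Proof.
move=> R R' no; apply/matrixP => a b; rewrite matrix_coef_avg mxE big1 // => c _.
set X := \sum_g _; have -> : X = 0 by apply: no => g; rewrite (trep_avg _ _ R R').
by rewrite mxE.
Qed.

(** Pairing with an elementary matrix under the trace reduces this to [tirr_ortho]. *)
Lemma tirr_ortho_dual m (rho : G -> 'M[F]_m) : trep alpha rho -> tirr rho ->
  \sum_g \tr (rho g) *: invmx (rho g) = (N / m%:R)%:M.
Proof.
move=> R irr; apply/matrixP => a b; rewrite -!mxtrace_mul_delta.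
rewrite mulmx_suml raddf_sum mul_scalar_mx -(tirr_ortho _ R irr) raddf_sum.
by apply: eq_bigr => g _; rewrite /= -scalemxAl !mxtraceZ mulrC.
Qed.

(** The inverse of u_g, since u_(g^-1) u_g is alpha(g^-1, g) alpha(1, 1) times the unit. *)
Definition tinv (g : G) : A :=
  (alpha g^-1%g g * alpha 1%g 1%g)^-1 *: tbasis alpha g^-1%g.

Definition tcomm : A :=
  \sum_g \sum_h tbasis alpha g * tbasis alpha h * tinv g * tinv h.

(** Summing over [g] first averages rho(h) to the scalar N tr(rho h) / m; dual orthogonality then
    gives the sum over [h]. *)
Lemma teval_tcomm m (rho : G -> 'M[F]_m) : trep alpha rho -> tirr rho ->
  teval rho tcomm = ((N / m%:R) ^+ 2)%:M.
Proof.
move=> R irr; rewrite /tcomm exchange_big linear_sum /=.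
have tinvE g : teval rho (tinv g) = invmx (rho g).
  by rewrite tevalZ teval_tbasis (trep_invmx g R).
transitivity (\sum_h (N / m%:R) *: (\tr (rho h) *: invmx (rho h))).
  apply: eq_bigr => h _; rewrite linear_sum /=.
  under eq_bigr do rewrite !tevalM // !tinvE !teval_tbasis [invmx _ *m (rho _ *m _)]mulmxA.
  rewrite -mulmx_sumr (tirr_avg _ R irr) mul_mx_scalar scalerA.
  by congr (_ *: _); rewrite mulrAC.
by rewrite -scaler_sumr (tirr_ortho_dual R irr) scale_scalar_mx.
Qed.

Lemma teval_tcommX m (rho : G -> 'M[F]_m) e : trep alpha rho -> tirr rho ->
  teval rho (tcomm ^+ e) = ((N / m%:R) ^+ (2 * e))%:M.
Proof.
move=> R irr; elim: e => [|e IH]; first by rewrite muln0 expr0 teval1.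
rewrite exprS tevalM // IH (teval_tcomm R irr) -scalar_mxM -exprD.
by rewrite mulnS addnC.
Qed.

(** * Fourier inversion for families of irreducible representations *)

Section Family.
Variables (k : nat) (d : 'I_k -> nat) (rho : forall i, G -> 'M[F]_(d i)).

Definition indep_irr : Prop :=
  [/\ forall i, trep alpha (rho i), forall i, tirr (rho i) &
      forall i j, i != j -> nohom (rho i) (rho j)].

(** Completeness is stated as joint faithfulness on the algebra; it makes Fourier inversion
    two-sided. *)
Definition complete_irr : Prop :=
  indep_irr /\ forall x : A, (forall i, teval (rho i) x = 0) -> x = 0.

Definition fourier_inv (M : forall i, 'M[F]_(d i)) : A :=
  [ffun g => N^-1 * \sum_i (d i)%:R * \tr (invmx (rho i g) *m M i) : F^o].

Lemma fourier_invK M i : indep_irr -> teval (rho i) (fourier_inv M) = M i.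
Proof.
move=> [R irr no].
transitivity (\sum_j (N^-1 * (d j)%:R) *:
    (\sum_g \tr (invmx (rho j g) *m M j) *: rho i g)).
  rewrite /teval; under [RHS]eq_bigr do rewrite scaler_sumr.
  rewrite exchange_big; apply: eq_bigr => g _ /=.
  rewrite ffunE mulr_sumr scaler_suml; apply: eq_bigr => j _.
  by rewrite scalerA mulrA.
rewrite (bigD1 i) //= [X in _ + X]big1 ?addr0 => [|j ji].
  rewrite (tirr_ortho _ (R i) (irr i)) scalerA.
  have d0 := irr_dim_neq0 (irr i).
  by rewrite [X in X *: _](_ : _ = 1) ?scale1r //; field; rewrite d0 N0.
by rewrite nohom_ortho ?scaler0 //; apply: no.
Qed.

Lemma fourierK x : complete_irr -> fourier_inv (fun i => teval (rho i) x) = x.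
Proof.
move=> [ind inj]; apply/eqP; rewrite -subr_eq0; apply/eqP/inj => i.
by rewrite linearB /= fourier_invK // subrr.
Qed.

(** Fourier inversion at 1, where each representation takes the scalar value [alpha 1 1]. *)
Lemma coef1_tcommX e : complete_irr ->
  N * alpha 1%g 1%g * (tcomm ^+ e : A) 1%g =
  \sum_i (d i)%:R ^+ 2 * ((N / (d i)%:R) ^+ 2) ^+ e.
Proof.
move=> C; rewrite -(fourierK (tcomm ^+ e) C); case: C => [[R irr _] _].
rewrite ffunE mulrACA mulfV // mul1r mulr_sumr; apply: eq_bigr => i _.
rewrite (teval_tcommX _ (R i) (irr i)) (proj1 (R i)) invmx_scalar.
rewrite mul_scalar_mx mxtraceZ mxtrace_scalar exprM -mulr_natl.
by field; rewrite cocycle_neq0.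
Qed.

(** Pairing the characters with the elements that act as 1 on one block and 0 on the others gives an
    invertible diagonal matrix of rank [k]. *)
Lemma indep_irr_leq : indep_irr -> (k <= #|G|)%N.
Proof.
move=> ind; have [R irr _] := ind.
pose V : 'M[F]_(k, #|G|) := \matrix_(i, g) \tr (rho i (enum_val g)).
pose e j i : 'M[F]_(d i) := (i == j)%:R%:M.
pose W : 'M[F]_(#|G|, k) :=
  \matrix_(g, j) (fourier_inv (e j)) (enum_val g).
have VW : V *m W = diag_mx (\row_i (d i)%:R).
  apply/matrixP => i j; rewrite !mxE.
  transitivity (\tr (teval (rho i) (fourier_inv (e j)))).
    rewrite /teval raddf_sum (reindex (@enum_val G predT)) /=.
      by apply: eq_bigr => g _; rewrite !mxE mxtraceZ mulrC.
    exact/onW_bij/enum_val_bij.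
  rewrite fourier_invK // mxtrace_scalar; case: (i == j); first by [].
  by rewrite mul0rn.
have : \rank (V *m W) = k.
  apply: mxrank_unit; rewrite unitmxE VW det_diag unitfE prodf_seq_neq0.
  by apply/allP => i _; rewrite mxE; apply: irr_dim_neq0 (irr i).
by move=> <-; apply: leq_trans (mxrankM_maxl _ _) (rank_leq_col _).
Qed.

End Family.
End Orthogonality.

(** * Complete families of irreducible representations *)

Section CompleteFamilies.
Variables (F : numClosedFieldType) (G : finGroupType) (alpha : cocycle F G).
Local Notation A := (twisted_algebra alpha).

(** By irreducibility of [rho], a non-zero intertwiner maps onto [rho] or is injective on it, and so
    carries the vanishing of [x] over to [rho]. *)
Lemma teval_hom_eq0 m m' (rho : G -> 'M[F]_m) (rho' : G -> 'M[F]_m') (x : A) :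
  tirr rho -> teval rho' x = 0 -> ~ (nohom rho rho' /\ nohom rho' rho) ->
  teval rho x = 0.
Proof.
move=> [_ irr] x0; have [no|/existsNP [X /not_implyP [XE X0]] _] := pselect (nohom rho rho').
  have [no'|/existsNP [X /not_implyP [XE X0]] _] := pselect (nohom rho' rho); first by case.
  have Xx : X *m teval rho x = 0 by rewrite -(teval_intertwine x XE) x0 mul0mx.
  have [g|X00|Xf] := irr <<X>>%MS.
  - by rewrite (eqmxMr _ (genmxE X)) genmxE -XE submxMl.
  - by case: X0; apply/eqP; rewrite -submx0 -X00 genmxE.
  rewrite -[LHS]mul1mx; apply/sub_kermxP; apply: submx_trans (submx_full 1%:M Xf) _.
  by rewrite genmxE; apply/sub_kermxP.
have xX : teval rho x *m X = 0 by rewrite (teval_intertwine x XE) x0 mulmx0.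
have [g|K0|Kf] := irr (kermx X).
- by apply/sub_kermxP; rewrite -mulmxA XE mulmxA mulmx_ker mul0mx.
- by apply/eqP; rewrite -submx0 -K0; apply/sub_kermxP.
by case: X0; have /sub_kermxP := submx_full 1%:M Kf; rewrite mul1mx.
Qed.

Local Notation T := {m : nat & G -> 'M[F]_m}.

(** Take an independent family of maximal length. If it kills [x], then so does every irreducible
    representation, as another one could be adjoined; hence [x] vanishes in the faithful regular
    representation. *)
Lemma complete_irr_exists :
  exists k (d : 'I_k -> nat) (rho : forall i, G -> 'M[F]_(d i)), complete_irr alpha rho.
Proof.
pose P k := `[< exists (d : 'I_k -> nat) (rho : forall i, G -> 'M[F]_(d i)),
                 indep_irr alpha rho >].
have P0 : exists k, P k.
  exists 0%N; apply/asboolP; exists (fun _ => 0%N), (fun _ _ => 0).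
  by split=> [[]|[]|[]].
have PG k : P k -> (k <= #|G|)%N.
  by move=> /asboolP [d [rho ind]]; apply: indep_irr_leq ind.
have [k /asboolP [d [rho ind]] kmax] := ex_maxnP P0 PG.
exists k, d, rho; split=> // x x0; have [R irr no] := ind.
apply/teval_reg_eq0/(trep_ind (alpha := alpha) (P := fun m r => teval r x = 0)) => //.
- by move=> r; apply: flatmx0.
- move=> m s sR sirr; apply: contrapT => sx.
  have nos i : nohom s (rho i) /\ nohom (rho i) s.
    by apply: contrapT => h; apply: sx; apply: teval_hom_eq0 sirr (x0 i) h.
  suff /kmax : P k.+1 by rewrite ltnn.
  pose t (i : 'I_k.+1) : T :=
    if unlift ord0 i is Some j then existT _ (d j) (rho j) else existT _ m s.
  pose nohomT (u v : T) := nohom (projT2 u) (projT2 v).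
  apply/asboolP; exists (fun i => projT1 (t i)), (fun i => projT2 (t i)); split.
  + by move=> i; rewrite /t; case: (unlift _ _) => [j|] /=; [apply: R|].
  + by move=> i; rewrite /t; case: (unlift _ _) => [j|] /=; [apply: irr|].
  have t0 : t ord0 = existT _ m s by rewrite /t unlift_none.
  have tl j : t (lift ord0 j) = existT _ (d j) (rho j) by rewrite /t liftK.
  move=> i j ij; rewrite -[nohom _ _]/(nohomT (t i) (t j)); move: ij.
  case: (unliftP ord0 i) => [i' ->|->]; case: (unliftP ord0 j) => [j' ->|->].
  + by rewrite (inj_eq lift_inj) !tl => /no.
  + by rewrite tl t0 => _; apply: (nos _).2.
  + by rewrite tl t0 => _; apply: (nos _).1.
  by rewrite eqxx.
- move=> m s k1 k2 r1 r2 B1 B2 _ full E1 E2 x1 x2.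
  rewrite -[LHS]mul1mx; apply/sub_kermxP; apply: submx_trans (submx_full 1%:M full) _.
  rewrite addsmx_sub; apply/andP; split; apply/sub_kermxP.
    by rewrite -(teval_intertwine x E1) x1 mul0mx.
  by rewrite -(teval_intertwine x E2) x2 mul0mx.
exact: treg_trep.
Qed.

(** Gives two families with the same multiset of dimensions the same dimension function, so that
    their blocks have the same type. *)
Lemma complete_irr_perm k (d e : 'I_k -> nat) (sigma : forall i, G -> 'M[F]_(e i)) :
  complete_irr alpha sigma -> perm_eq [seq d i | i : 'I_k] [seq e i | i : 'I_k] ->
  exists rho : forall i, G -> 'M[F]_(d i), complete_irr alpha rho.
Proof.
move=> [[R irr no] inj] de.
have [p dp] : exists p : 'S_k, forall i, d i = e (p i).
  have /tuple_permP [p pE] : perm_eq [tuple d i | i < k] [tuple e i | i < k].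
    by apply: de.
  exists p => i; have /(congr1 (fun u => tnth u i)) := val_inj pE.
  by rewrite !tnth_mktuple.
(* Equality of dependent pairs replaces casts along [dp i]. *)
have ex i : exists r : G -> 'M_(d i), existT _ (d i) r = existT _ (e (p i)) (sigma (p i)) :> T.
  by move: (dp i); move: (d i) => m ->; exists (sigma (p i)).
pose rho i := sval (cid (ex i)).
have rhoE i : existT _ (d i) (rho i) = existT _ (e (p i)) (sigma (p i)) :> T.
  by rewrite /rho; case: (cid _).
exists rho; split; first split.
- move=> i; rewrite -[trep _ _]/((fun u : T => trep alpha (projT2 u)) (existT _ _ (rho i))).
  by rewrite rhoE; apply: R.
- move=> i; rewrite -[tirr _]/((fun u : T => tirr (projT2 u)) (existT _ _ (rho i))).
  by rewrite rhoE; apply: irr.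
- move=> i j ij; pose nohomT (u v : T) := nohom (projT2 u) (projT2 v).
  rewrite -[nohom _ _]/(nohomT (existT _ _ (rho i)) (existT _ _ (rho j))) !rhoE.
  by apply: no; rewrite (inj_eq perm_inj).
move=> x x0; apply: inj => i; have := x0 (p^-1 i)%g.
rewrite -[teval _ _ = 0]/((fun u : T => teval (projT2 u) x = 0) (existT _ _ (rho _))).
by rewrite rhoE permKV.
Qed.

End CompleteFamilies.

(** The Fourier transform for [alpha] is followed by inversion for [beta]; evaluation reverses
    products on both sides, so the composite preserves them. *)
Lemma complete_irr_alg_iso (F : numClosedFieldType) (G : finGroupType)
    (alpha beta : cocycle F G) k (d : 'I_k -> nat) (rho sigma : forall i, G -> 'M[F]_(d i)) :
  complete_irr alpha rho -> complete_irr beta sigma ->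
  alg_iso (twisted_algebra alpha) (twisted_algebra beta).
Proof.
move=> Ca Cb; have [[[Ra _ _] _] [indb injb]] := (Ca, Cb); have [Rb _ _] := indb.
pose f (x : twisted_algebra alpha) := fourier_inv beta sigma (fun i => teval (rho i) x).
have fE x i : teval (sigma i) (f x) = teval (rho i) x by apply: fourier_invK.
have inj (x y : twisted_algebra beta) :
    (forall i, teval (sigma i) x = teval (sigma i) y) -> x = y.
  move=> xy; apply/eqP; rewrite -subr_eq0; apply/eqP/injb => i.
  by rewrite linearB /= xy subrr.
apply: (@alg_isoI _ _ _ f) => [a x y||x y|].
- by apply: inj => i; rewrite fE !teval_linear !fE.
- by apply: inj => i; rewrite fE !teval1.
- by apply: inj => i; rewrite fE !tevalM // !fE.
exists (fun y => fourier_inv alpha rho (fun i => teval (sigma i) y)) => x.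
  rewrite -[RHS](fourierK x Ca); congr fourier_inv.
  by apply: functional_extensionality_dep => i; rewrite fE.
by apply: inj => i; rewrite fE fourier_invK //; case: Ca.
Qed.

(** By linearity, any polynomial may replace the power. One that vanishes at the values of all
    entries except [v] isolates the multiplicity of [v]. *)
Lemma perm_eq_power_sums (F : numFieldType) (N : F) (s t : seq nat) : N != 0 ->
  all (fun x => 0 < x)%N s -> all (fun x => 0 < x)%N t ->
  (forall e, \sum_(x <- s) x%:R ^+ 2 * ((N / x%:R) ^+ 2) ^+ e =
             \sum_(x <- t) x%:R ^+ 2 * ((N / x%:R) ^+ 2) ^+ e) ->
  perm_eq s t.
Proof.
move=> N0 /allP s0 /allP t0 st.
have stp (q : {poly F}) : \sum_(x <- s) x%:R ^+ 2 * q.[(N / x%:R) ^+ 2] =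
             \sum_(x <- t) x%:R ^+ 2 * q.[(N / x%:R) ^+ 2].
  under eq_bigr do rewrite horner_coef mulr_sumr.
  under [RHS]eq_bigr do rewrite horner_coef mulr_sumr.
  rewrite exchange_big [RHS]exchange_big; apply: eq_bigr => i _ /=.
  under eq_bigr do rewrite mulrCA.
  under [RHS]eq_bigr do rewrite mulrCA.
  by rewrite -!mulr_sumr st.
apply/allP => v vst /=.
have pos x : x \in s ++ t -> (0 < x)%N by rewrite mem_cat => /orP [/s0|/t0].
have inj x y : x \in s ++ t -> y \in s ++ t ->
    ((N / x%:R) ^+ 2 == (N / y%:R) ^+ 2 :> F) = (x == y).
  move=> /pos x0 /pos y0; apply/eqP/eqP => [|-> //].
  have xF : (x%:R : F) != 0 by rewrite pnatr_eq0 -lt0n.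
  have yF : (y%:R : F) != 0 by rewrite pnatr_eq0 -lt0n.
  rewrite !expr_div_n => /(mulfI (expf_neq0 2 N0)) /invr_inj /eqP.
  by rewrite -!natrX eqr_nat eqn_sqr => /eqP.
pose q : {poly F} := \prod_(w <- undup (s ++ t) | w != v) ('X - ((N / w%:R) ^+ 2)%:P).
have qE x : x \in s ++ t -> (q.[(N / x%:R) ^+ 2] != 0) = (x == v).
  move=> xst; rewrite /q horner_prod prodf_seq_neq0; apply/allP/eqP => [h|-> w].
    apply/eqP/negPn/negP => xv; have := h x; rewrite mem_undup xst => /(_ isT).
    by rewrite xv hornerXsubC subrr eqxx.
  rewrite mem_undup => wst; apply/implyP => wv.
  by rewrite hornerXsubC subr_eq0 inj // eq_sym.
pose c := v%:R ^+ 2 * q.[(N / v%:R) ^+ 2].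
have c0 : c != 0.
  by rewrite mulf_neq0 ?qE // expf_neq0 // pnatr_eq0 -lt0n pos.
have cE (u : seq nat) : {subset u <= s ++ t} ->
    \sum_(x <- u) x%:R ^+ 2 * q.[(N / x%:R) ^+ 2] = c *+ count_mem v u.
  move=> ust; transitivity (\sum_(x <- u | x == v) c).
    rewrite [RHS]big_mkcond; apply: eq_big_seq => x /ust xst.
    case: eqP => [->//|/eqP xv]; apply/eqP; rewrite mulf_eq0 -[_ || _]negbK negb_or.
    by rewrite qE // (negPf xv) andbF.
  by rewrite big_const_seq iter_addr addr0.
have := stp q; rewrite !cE; last 2 first.
- by move=> x xs; rewrite mem_cat xs orbT.
- by move=> x xs; rewrite mem_cat xs.
by move/eqP; rewrite -!(mulr_natr c) (inj_eq (mulfI c0)) eqr_nat.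
Qed.

(** * Galois conjugation of cocycles *)

Lemma root_Cyclotomic_map (F : numFieldType) n (z : F) : n.-primitive_root z ->
  root (map_poly intr 'Phi_n) z.
Proof.
move=> zn; have n0 := prim_order_gt0 zn.
have : root (map_poly (intr : int -> F) ('X^n - 1)) z.
  by rewrite rmorphB rmorph1 /= map_polyXn rootE !hornerE prim_expr_order // subrr.
rewrite -prod_Cyclotomic // rmorph_prod rootE horner_prod prodf_seq_eq0.
case/hasP => m; rewrite -dvdn_divisors // => mn /= zm.
have m0 : (0 < m)%N by apply: dvdn_gt0 mn.
suff : z ^+ m == 1.
  by rewrite -(prim_order_dvd zn) => nm; have /eqP <- : m == n by rewrite eqn_dvd mn.
rewrite -subr_eq0; have : root (map_poly (intr : int -> F) ('X^m - 1)) z.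
  rewrite -prod_Cyclotomic // rmorph_prod rootE horner_prod prodf_seq_eq0.
  by apply/hasP; exists m; rewrite // -dvdn_divisors.
by rewrite rmorphB rmorph1 /= map_polyXn rootE !hornerE.
Qed.

(** By irreducibility over the rationals, the n-th cyclotomic polynomial divides [p]. *)
Lemma root_primitive_transfer (F : numFieldType) n (z z' : F) (p : {poly rat}) :
  n.-primitive_root z -> n.-primitive_root z' ->
  root (map_poly ratr p) z -> root (map_poly ratr p) z'.
Proof.
move=> zn z'n pz; have n0 := prim_order_gt0 zn.
pose Phi : {poly rat} := map_poly intr 'Phi_n.
have mapPhi (K : numFieldType) : map_poly ratr Phi = map_poly intr 'Phi_n :> {poly K}.
  by rewrite -map_poly_comp; apply: eq_map_poly => x /=; rewrite ratr_int.
suff PhiP : Phi %| p.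
  have := PhiP; rewrite -(dvdp_map (ratr : {rmorphism rat -> F})) => /dvdpP [q ->].
  by rewrite rootM mapPhi root_Cyclotomic_map ?orbT.
pose D := gcdp p Phi.
have Dz : root (map_poly ratr D) z.
  by rewrite gcdp_map root_gcd pz mapPhi root_Cyclotomic_map.
(* A common root with [Phi] is moved to [algC], where [Phi] is the minimal polynomial of each
   primitive n-th root of unity. *)
have [w wD] : exists w : algC, root (map_poly ratr D) w.
  apply/closed_rootP; rewrite size_map_poly; apply/eqP => s1.
  have /size_poly1P [c c0 cD] : size D == 1%N by rewrite s1.
  by move: Dz; rewrite cD map_polyC rootC fmorph_eq0 (negPf c0).
have wp : root (map_poly ratr p) w.
  by move: wD; rewrite gcdp_map root_gcd => /andP [].
have [w0 w0n] := C_prim_root_exists n0.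
have wn : n.-primitive_root w.
  rewrite -(root_cyclotomic w0n) -(Cintr_Cyclotomic w0n) -mapPhi.
  by move: wD; rewrite gcdp_map root_gcd => /andP [].
have [m [mE _] mP] := minCpolyP w.
rewrite mP in wp; suff -> : Phi = m by [].
apply: (map_poly_inj (ratr : {rmorphism rat -> algC})).
by rewrite -mE mapPhi (Cintr_Cyclotomic wn) (minCpoly_cyclotomic wn).
Qed.

Section GaloisPairs.
Variables (F : numClosedFieldType) (n r : nat) (z : F).
Hypotheses (zn : n.-primitive_root z) (rn : coprime r n).

(* The graph of the automorphism z |-> z^r of the field Q(z). *)
Definition gal_pair (x y : F) : Prop :=
  exists p : {poly rat}, x = (map_poly ratr p).[z] /\ y = (map_poly ratr p).[z ^+ r].

Lemma gal_pairD x y x' y' : gal_pair x y -> gal_pair x' y' -> gal_pair (x + x') (y + y').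
Proof. by move=> [p [-> ->]] [q [-> ->]]; exists (p + q); rewrite rmorphD !hornerD. Qed.

Lemma gal_pairM x y x' y' : gal_pair x y -> gal_pair x' y' -> gal_pair (x * x') (y * y').
Proof. by move=> [p [-> ->]] [q [-> ->]]; exists (p * q); rewrite rmorphM !hornerM. Qed.

Lemma gal_pair_rat (a : rat) : gal_pair (ratr a) (ratr a).
Proof. by exists a%:P; rewrite map_polyC !hornerC. Qed.

Lemma gal_pair_nat (a : nat) : gal_pair a%:R a%:R.
Proof. by rewrite -[a%:R]ratr_nat; apply: gal_pair_rat. Qed.

Lemma gal_pair_unity w : w ^+ n = 1 -> gal_pair w (w ^+ r).
Proof.
case/(prim_rootP zn) => j ->; exists 'X^j.
by rewrite map_polyXn !hornerXn -!exprM mulnC.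
Qed.

(** The rational polynomial [p - a%:P] vanishes at [z], hence at its conjugate z^r. *)
Lemma gal_pair_fixed (a : rat) y : gal_pair (ratr a) y -> y = ratr a.
Proof.
move=> [p [pz ->]]; apply/eqP; rewrite -subr_eq0.
have z'n : n.-primitive_root (z ^+ r) by rewrite prim_root_exp_coprime.
have := @root_primitive_transfer F n z (z ^+ r) (p - a%:P) zn z'n.
rewrite rmorphB /= map_polyC /= !rootE !hornerE => -> //.
by rewrite -pz subrr.
Qed.

Variables (G : finGroupType) (alpha beta : cocycle F G).
Hypotheses (alpha_n : forall g h, alpha g h ^+ n = 1)
  (alphaX : forall g h, beta g h = alpha g h ^+ r).

Definition alg_pair (x : twisted_algebra alpha) (y : twisted_algebra beta) : Prop :=
  forall g, gal_pair (x g) (y g).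

Lemma gal_pair_alpha g h : gal_pair (alpha g h) (beta g h).
Proof. by rewrite alphaX; apply: gal_pair_unity. Qed.

Lemma gal_pair_alphaV g h : gal_pair (alpha g h)^-1 (beta g h)^-1.
Proof.
by rewrite alphaX -exprVn; apply: gal_pair_unity; rewrite exprVn alpha_n invr1.
Qed.

Lemma alg_pair_tbasis g : alg_pair (tbasis alpha g) (tbasis beta g).
Proof. by move=> h; rewrite !tbasisE; apply: gal_pair_nat. Qed.

Lemma alg_pairZ a b x y : gal_pair a b -> alg_pair x y -> alg_pair (a *: x) (b *: y).
Proof. by move=> ab xy g; rewrite !tcoordZ; apply: gal_pairM. Qed.

Lemma alg_pair_sum (x : G -> twisted_algebra alpha) (y : G -> twisted_algebra beta) :
  (forall g, alg_pair (x g) (y g)) -> alg_pair (\sum_g x g) (\sum_g y g).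
Proof.
move=> xy; elim/big_ind2: _ => // [g|u v u' v' uv u'v' g].
  by rewrite !ffunE; apply: (gal_pair_nat 0).
by rewrite !tcoordD; apply: gal_pairD.
Qed.

Lemma alg_pairM x y x' y' : alg_pair x y -> alg_pair x' y' -> alg_pair (x * x') (y * y').
Proof.
move=> xy xy'.
rewrite !talg_mulE; apply: alg_pair_sum => g; apply: alg_pair_sum => h; apply: alg_pairZ.
  by apply: gal_pairM (gal_pair_alpha g h); apply: gal_pairM.
exact: alg_pair_tbasis.
Qed.

Lemma alg_pair_tinv g : alg_pair (tinv alpha g) (tinv beta g).
Proof.
apply: alg_pairZ; last exact: alg_pair_tbasis.
by rewrite !invfM; apply: gal_pairM; apply: gal_pair_alphaV.
Qed.

Lemma alg_pair_tcommX e : alg_pair (tcomm alpha ^+ e) (tcomm beta ^+ e).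
Proof.
elim: e => [|e IH].
  by rewrite !expr0 !talg_oneE; apply: alg_pairZ (alg_pair_tbasis 1%g); apply: gal_pair_alphaV.
rewrite !exprS; apply: alg_pairM IH.
apply: alg_pair_sum => g; apply: alg_pair_sum => h.
by do 3?apply: alg_pairM; (apply: alg_pair_tinv || apply: alg_pair_tbasis).
Qed.

Lemma root_of_unity_alg_iso : alg_iso (twisted_algebra alpha) (twisted_algebra beta).
Proof.
have [k [d [rho C]]] := complete_irr_exists alpha.
have [l [e [sigma C']]] := complete_irr_exists beta.
have N0 := card_group_neq0 F G.
have de : perm_eq [seq d i | i : 'I_k] [seq e i | i : 'I_l].
  apply: (perm_eq_power_sums N0).
  - by apply/allP => _ /imageP [i _ ->]; case: C => [[_ /(_ i) []]].
  - by apply/allP => _ /imageP [i _ ->]; case: C' => [[_ /(_ i) []]].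
  move=> j; rewrite !big_image /= -(coef1_tcommX j C) -(coef1_tcommX j C').
  (* The dimensions are natural numbers, so the sum for [alpha] is rational and its conjugate, the
     sum for [beta], equals it. *)
  pose S : rat := \sum_i (d i)%:R ^+ 2 * ((#|G|%:R / (d i)%:R) ^+ 2) ^+ j.
  have SE : #|G|%:R * alpha 1%g 1%g * (tcomm alpha ^+ j : twisted_algebra alpha) 1%g =
      ratr S.
    rewrite (coef1_tcommX j C) rmorph_sum; apply: eq_bigr => i _ /=.
    by rewrite rmorphM !rmorphXn /= fmorph_div /= !ratr_nat.
  rewrite SE; apply/esym/gal_pair_fixed; rewrite -SE.
  apply: gal_pairM (alg_pair_tcommX j 1%g); apply: gal_pairM (gal_pair_alpha _ _).
  exact: gal_pair_nat.
have kl : l = k by have := perm_size de; rewrite !size_image !card_ord.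
subst l; have [tau Ct] := complete_irr_perm C' de.
exact: complete_irr_alg_iso C Ct.
Qed.

End GaloisPairs.

(** * Powers of a cocycle *)

(** X^n - 1 is separable, so it has n distinct roots, and one of them is primitive. *)
Lemma prim_root_exists (F : numClosedFieldType) n : (0 < n)%N ->
  exists z : F, n.-primitive_root z.
Proof.
move=> n0; pose p : {poly F} := 'X^n - 1.
have [s pE] := closed_field_poly_normal p.
have mp : lead_coef p = 1 by apply/monicP; rewrite monicXnsubC.
rewrite mp scale1r in pE.
have us : uniq s.
  by rewrite -separable_prod_XsubC -pE separable_Xn_sub_1 // pnatr_eq0 -lt0n.
suff /hasP [z _ zn] : has n.-primitive_root s by exists z.
apply: has_prim_root => //.
  by apply/allP => z; rewrite -root_prod_XsubC -pE.
by rewrite -ltnS -(size_prod_XsubC _ id) -pE size_XnsubC.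
Qed.

Section Powers.
Variables (F : numClosedFieldType) (G : finGroupType).
Implicit Types alpha : cocycle F G.

(** Dividing [alpha] by the coboundary of n-th roots of [lam] makes its n-th power 1. *)
Lemma cocycle_unity_normalization alpha n : (0 < n)%N -> coboundary (cocycle_exp alpha n) ->
  exists (alpha0 : cocycle F G) (mu : G -> F), [/\ forall g, mu g != 0,
    forall g h, alpha g h = alpha0 g h * (mu g * mu h / mu (g * h)%g) &
    forall g h, alpha0 g h ^+ n = 1].
Proof.
move=> n0 [lam [lam0 lamE]]; pose mu g := n.-root (lam g).
have muX g : mu g ^+ n = lam g by rewrite rootCK.
have mu0 g : mu g != 0 by rewrite rootC_eq0.
pose a g h := alpha g h * (mu (g * h)%g / (mu g * mu h)).
have a0 g h : a g h != 0 by rewrite !mulf_neq0 ?invr_eq0 ?mulf_neq0 ?cocycle_neq0.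
have aP g h k : a g h * a (g * h)%g k = a h k * a g (h * k)%g.
  rewrite /a mulrACA cocycleP [RHS]mulrACA; congr (_ * _).
  by rewrite !mulgA; field; rewrite !mu0.
exists (Cocycle a0 aP), mu; split=> // g h /=; rewrite /a.
  by field; rewrite !mu0.
rewrite !exprMn exprVn exprMn !muX; have /= -> := lamE g h.
by field; rewrite !lam0.
Qed.

(** Pass from [alpha] to its normalisation [a], then to a^r by conjugation, then to alpha^r by the
    coboundary of mu^(-r). *)
Lemma coprime_twisted_alg_iso alpha n r : class_has_order alpha n -> coprime r n ->
  alg_iso (twisted_algebra alpha) (twisted_algebra (cocycle_exp alpha r)).
Proof.
move=> [n0 an _] rn; have [z zn] := prim_root_exists F n0.
have [a [mu [mu0 muE a1]]] := cocycle_unity_normalization n0 an.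
apply: alg_iso_trans (cohomologous_alg_iso mu0 muE) _.
apply: alg_iso_trans (root_of_unity_alg_iso zn rn a1 (beta := cocycle_exp a r) _) _ => //.
apply: (cohomologous_alg_iso (lam := fun g => mu g ^- r)) => [g|g h /=].
  by rewrite invr_eq0 expf_neq0.
rewrite muE !exprMn exprVn invrK -!mulrA; apply: esym.
rewrite -[RHS]mulr1; congr (_ * _).
have X g' : mu g' ^+ r != 0 by rewrite expf_neq0.
by field; rewrite !X.
Qed.

Lemma irr_dim_gcd_gt0 alpha : (0 < irr_dim_gcd alpha)%N.
Proof.
have [cdvd _] := trep_dim_gcd alpha.
by apply: dvdn_gt0 (cdvd _ (trep_dim_reg alpha)); apply/card_gt0P; exists 1%g.
Qed.

Lemma twisted_algebra_power alpha n r : class_has_order alpha n ->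
  [/\ coprime r n ->
        alg_iso (twisted_algebra alpha) (twisted_algebra (cocycle_exp alpha r)),
      ~~ coprime r n ->
        (irr_dim_gcd (cocycle_exp alpha r) < irr_dim_gcd alpha)%N &
      alg_iso (twisted_algebra alpha) (twisted_algebra (cocycle_exp alpha r))
        <-> gcdn n r = 1%N].
Proof.
move=> hn; have iso := @coprime_twisted_alg_iso alpha n r hn.
have lt : ~~ coprime r n -> (irr_dim_gcd (cocycle_exp alpha r) < irr_dim_gcd alpha)%N.
  move=> nrn; apply: trep_dim_gcd_lt hn nrn (irr_dim_gcd_gt0 _) _ _; exact: trep_dim_gcd.
split=> //; split=> [ab|/eqP]; last by rewrite gcdnC; apply: iso.
(* Isomorphic algebras have the same representation dimensions, which contradicts the strict
   inequality of gcds. *)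
apply/eqP; rewrite gcdnC; apply: contraT => /lt; rewrite ltnNge => /negP [].
apply: dvdn_leq (irr_dim_gcd_gt0 _) _.
apply: (proj2 (trep_dim_gcd _)) => m /(alg_iso_trep_dim ab).
exact: (proj1 (trep_dim_gcd alpha)).
Qed.

End Powers.

Theorem theorem3p1 (R : realType) (G : finGroupType)
    (alpha : cocycle R[i] G) (n r : nat) (hn : class_has_order alpha n) :
  [/\ coprime r n ->
        alg_iso (twisted_algebra alpha) (twisted_algebra (cocycle_exp alpha r)),
      ~~ coprime r n ->
        (irr_dim_gcd (cocycle_exp alpha r) < irr_dim_gcd alpha)%N &
      alg_iso (twisted_algebra alpha) (twisted_algebra (cocycle_exp alpha r))
        <-> gcdn n r = 1%N].
Proof. exact: (@twisted_algebra_power R[i]). Qed.
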